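(* If $X$ is a regular space and its co-diagonal $\Delta^c_X=(X\times X)\setminus\Delta_X$ is discretely Lindelöf, then $X$ has small diagonal.
   Context: All spaces are topological spaces assumed to be $T_1$. $\Delta_X=\{(x,x):x\in X\}$ is the diagonal of $X$. A space is Lindelöf if every open cover has a countable subcover. A space $Z$ is discretely Lindelöf if the closure (in $Z$) of every discrete subset $D\subset Z$ (i.e. $D$ discrete in its subspace topology) is Lindelöf. A space $X$ has small diagonal if for any uncountable set $A\subset\Delta^c_X$ there exists an uncountable $B\subset A$ such that $\overline{B}\cap\Delta_X=\emptyset$, where the closure is taken in $X\times X$. *)

(* Defs.v *)
From mathcomp Require Import all_boot all_order all_algebra.
From mathcomp Require Import all_classical all_reals all_analysis.

Set Implicit Arguments.
Unset Strict Implicit.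
Unset Printing Implicit Defensive.

Local Open Scope classical_set_scope.

(* A set used as a type is coerced to [set_type A], which carries the initial
   topology of the inclusion, i.e. the usual subspace topology. *)

Definition lindelof_space (Z : topologicalType) : Prop :=
  forall U : set (set Z),
    (forall u, U u -> open u) -> \bigcup_(u in U) u = [set: Z] ->
  exists V : set (set Z),
    [/\ V `<=` U, countable V & \bigcup_(v in V) v = [set: Z]].

Definition discrete_subset (Z : topologicalType) (D : set Z) : Prop :=
  forall U : set (set_type D), open U.

Definition discretely_lindelof (Z : topologicalType) : Prop :=
  forall D : set Z, discrete_subset D -> lindelof_space (set_type (closure D)).

Definition codiagonal (X : Type) : set (X * X) := ~` diagonal.
Arguments codiagonal X : clear implicits.

Definition small_diagonal (X : topologicalType) : Prop :=
  forall A : set (X * X), A `<=` codiagonal X -> ~ countable A ->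
  exists B : set (X * X),
    [/\ B `<=` A, ~ countable B & closure B `&` diagonal = set0].

(* Main.v *)
Require Import Defs.
From mathcomp Require Import all_boot all_order all_algebra.
From mathcomp Require Import all_classical all_reals all_analysis.
From mathcomp Require wochoice.

(** Suppose that some uncountable [A] off the diagonal has no uncountable
    subset whose closure misses the diagonal.  By regularity, every point off
    the diagonal has an open neighbourhood whose closure misses the diagonal;
    the closure of the trace of [A] on it misses the diagonal as well, so this
    trace must be countable.
    Thus [A] is locally countable in the co-diagonal [Z]
    ([codiagonal_nbhs_closure]).

    It remains to see that a locally countable subset [A] of a discretely
    Lindelof space [Z] is countable ([locally_countable_countable]).  Assign to
    each point [z] an open neighbourhood [W z] with countable trace on [A].
    Shapirovskii's lemma ([shapirovskii]) produces a discrete [D] inside [A]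
    such that [A] is covered by [closure D] and the sets [W d], [d] in [D].
    Since [closure D] is Lindelof, countably many sets [W z] cover it, so it
    meets [A] in a countable set.  In particular [D] is countable, hence so is
    the part of [A] covered by the sets [W d]. *)

Set Implicit Arguments.
Unset Strict Implicit.
Unset Printing Implicit Defensive.

Local Open Scope classical_set_scope.

(** The well-ordering principle with a strict order, which is the form that
    well-founded recursion consumes. *)
Lemma well_founded_total (T : eqType) :
  exists lt : T -> T -> Prop,
    well_founded lt /\ forall x y, x <> y -> lt x y \/ lt y x.
Proof.
have [R Rwo] := wochoice.well_ordering_principle T.
exists (fun x y => ~~ R y x); split.
  move=> x; apply: contrapT => nAx.
  have [|m [[]]] := Rwo [pred y | `[< ~ Acc (fun x y => ~~ R y x) y >]].
    by exists x; apply/asboolP.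
  move=> /asboolP nAm mmin _; apply: nAm; constructor => y nRmy.
  by apply: contrapT => /asboolP nAy; move: nRmy; rewrite mmin.
move=> x y xy; apply: contrapT => /not_orP[/negP/negPn Ryx /negP/negPn Rxy].
have Rxx z : R z z.
  have [|m [[]]] := Rwo (pred1 z); first by exists z; rewrite inE.
  by rewrite inE => /eqP -> /(_ z); rewrite inE eqxx => ->.
have [|m [_ muniq]] := Rwo (pred2 x y); first by exists x; rewrite !inE eqxx.
(* Were [x] and [y] below each other, both would be least in [{x, y}]. *)
apply: xy; rewrite -(muniq x) ?(muniq y) //; split;
  by rewrite ?inE ?eqxx ?orbT // => z; rewrite !inE => /orP[]/eqP->.
Qed.

(** Transfinite selection: the criterion [P] for choosing [x] may depend on the
    set of points chosen before [x]. *)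
Lemma well_founded_set (T : Type) (lt : T -> T -> Prop)
    (P : T -> set T -> Prop) :
  well_founded lt ->
  exists D : set T, forall x, D x <-> P x [set y | lt y x /\ D y].
Proof.
move=> wf.
pose F x (f : forall y, lt y x -> Prop) : Prop :=
  P x [set y | exists h : lt y x, f y h].
exists (Fix wf (fun=> Prop) F) => x.
rewrite Fix_eq; last first.
  by move=> {}x f g fg; congr (F x _); apply/functional_extensionality_dep => y;
     apply/functional_extensionality_dep => h.
rewrite /F; set L := (X in P x X <-> _); set M := (X in _ <-> P x X).
suff -> : L = M by [].
by apply/seteqP; split => y [].
Qed.

Lemma countableU (T : Type) (A B : set T) :
  countable A -> countable B -> countable (A `|` B).
Proof.
move=> Acnt Bcnt; rewrite -bigcup2E; apply: bigcup_countable => // i _.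
by rewrite /bigcup2; case: ifP => // _; case: ifP => // _; apply: countable0.
Qed.

Lemma discrete_subsetP (Z : topologicalType) (D : set Z) :
  (forall d, D d -> exists2 N, nbhs d N & forall e, D e -> N e -> e = d) ->
  discrete_subset D.
Proof.
move=> isolD U; rewrite openE => u Uu.
have [N Nu Nuniq] := isolD _ (set_mem (valP u)).
have : nbhs u (set_val @^-1` N) by apply: initial_continuous.
apply: filterS => v /= Nv.
suff -> : v = u by [].
exact/val_inj/Nuniq/Nv/set_mem/valP.
Qed.

(** The reason is a greedy choice: run through [A] along a well-ordering and put a point into [D] when it lies
    neither in the closure of the points already chosen nor in one of their
    neighbourhoods.  Then [W d] keeps out the points of [D] after [d], and the
    complement of the closure of the earlier points keeps those out. *)
Lemma shapirovskii (Z : topologicalType) (A : set Z) (W : Z -> set Z) :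
  (forall z, open_nbhs z (W z)) ->
  exists D : set Z, [/\ D `<=` A, discrete_subset D &
    A `<=` closure D `|` \bigcup_(d in D) W d].
Proof.
move=> Wz; have [lt [wf lt_total]] := well_founded_total Z.
have [D DE] := well_founded_set (fun x E =>
  [/\ A x, ~ closure E x & ~ (\bigcup_(d in E) W d) x]) wf.
exists D; split => [x /DE[]//| |x Ax].
  apply: discrete_subsetP => d Dd.
  have [_ ncl _] := (DE d).1 Dd.
  exists (W d `&` ~` closure [set y | lt y d /\ D y]).
    apply: filterI; first exact/open_nbhs_nbhs/Wz.
    by apply: open_nbhs_nbhs; split=> //; apply/closed_openC/closed_closure.
  move=> e De [We ncle]; apply: contrapT => /lt_total[ed|de].
    by apply/ncle/subset_closure; split.
  by have [_ _] := (DE e).1 De; apply; exists d.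
have [Dx|nDx] := pselect (D x); first by left; apply: subset_closure.
apply: contrapT => /not_orP[ncl nW]; apply/nDx/DE; split=> //.
  by move=> /closureS-/(_ D) h; apply/ncl/h => y [].
by move=> [d [_ Dd] Wdx]; apply: nW; exists d.
Qed.

Lemma lindelof_locally_countable (Z : topologicalType) (A F : set Z)
    (W : Z -> set Z) :
  (forall z, open_nbhs z (W z)) -> (forall z, countable (A `&` W z)) ->
  lindelof_space (set_type F) -> countable (A `&` F).
Proof.
move=> Wz AW /(_ [set u | exists z, u = set_val @^-1` W z])[||V [VU Vcnt VT]].
- move=> _ [z ->]; apply: open_comp; last by have [] := Wz z.
  by move=> ? _; apply: initial_continuous.
- apply/seteqP; split=> // u _; exists (set_val @^-1` W (val u)).
    by exists (val u).
  by have [_] := Wz (val u).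
have : countable (\bigcup_(v in V) (A `&` set_val @` v)).
  apply: bigcup_countable => // v /VU[z ->].
  apply: sub_countable (AW z); apply: subset_card_le.
  by move=> x [Ax [u Wu ux]]; split=> //; rewrite -ux; exact: Wu.
apply: sub_countable; apply: subset_card_le => x [Ax Fx].
have [v Vv vx] : (\bigcup_(v in V) v) (SigSub (mem_set Fx)) by rewrite VT.
by exists v => //; split=> //; exists (SigSub (mem_set Fx)).
Qed.

Lemma locally_countable_countable (Z : topologicalType) (A : set Z) :
  discretely_lindelof Z ->
  (forall z, exists2 N, open_nbhs z N & countable (A `&` N)) ->
  countable A.
Proof.
move=> dL /(_ _)/cid2-/all_sig2[W Wz AW].
have [D [DA Ddisc AD]] := shapirovskii A Wz.
have AclD : countable (A `&` closure D).
  exact/(lindelof_locally_countable Wz AW)/dL.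
have Dcnt : countable D.
  apply: sub_countable AclD; apply: subset_card_le => d Dd.
  by split; [exact: DA|exact: subset_closure].
have : countable ((A `&` closure D) `|` \bigcup_(d in D) (A `&` W d)).
  by apply: countableU => //; apply: bigcup_countable.
apply: sub_countable; apply: subset_card_le => x Ax.
by have [|[d Dd Wdx]] := AD x Ax; [left|right; exists d].
Qed.

(** Two distinct points of a regular T1 space have neighbourhoods with disjoint
    closures: shrink first around [x] away from [y], then around [y] away from
    the closed neighbourhood of [x].  A diagonal point in the closure of the
    product of these neighbourhoods would have its coordinate in both closures. *)
Lemma codiagonal_nbhs_closure (X : topologicalType) (p : X * X) :
  accessible_space X -> regular_space X -> codiagonal X p ->
  exists2 N, open_nbhs p N & closure N `&` diagonal = set0.
Proof.
move: p => [x y] T1 reg xy.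
have [M Mx clM] : exists2 M, nbhs x M & closure M `<=` ~` [set y].
  apply: reg; apply: open_nbhs_nbhs; split; last by move=> /= e; apply: xy.
  exact/closed_openC/accessible_closed_set1.
have [N Ny clN] : exists2 N, nbhs y N & closure N `<=` ~` closure M.
  apply: reg; apply: open_nbhs_nbhs; split; last by move=> /clM; apply.
  exact/closed_openC/closed_closure.
exists (interior (M `*` N)).
  split; first exact: open_interior.
  by exists (M, N).
rewrite -subset0 => -[a b] [cl /= ab]; rewrite /diagonal /= in ab; subst b.
have {}cl : closure (M `*` N) (a, a) by apply: closureS cl; apply: interior_subset.
apply: (clN a) => B Ba.
  have [|[u v] [[_ /= Nv] [_ /= Bv]]] := cl (setT `*` B).
    by exists (setT, B) => //; split=> //; apply: filterT.
  by exists v.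
have [|[u v] [[/= Mu _] [/= Bu _]]] := cl (B `*` setT).
  by exists (B, setT) => //; split=> //; apply: filterT.
by exists u.
Qed.

(* [accessible_space] is T1; [regular_space] alone does not include it. *)
Theorem corollary3p24 (X : topologicalType)
    (X_T1 : accessible_space X) (X_regular : regular_space X)
    (X_codiag : discretely_lindelof (set_type (codiagonal X))) :
  small_diagonal X.
Proof.
move=> A AZ Aunc; apply: contrapT => nB; apply: Aunc.
have Acnt : countable (set_val @^-1` A : set (set_type (codiagonal X))).
  apply: locally_countable_countable => // z.
  have [N [Nop Nz] clN] :=
    codiagonal_nbhs_closure X_T1 X_regular (set_mem (valP z)).
  exists (set_val @^-1` N).
    split; last exact: Nz.
    by apply: open_comp => // ? _; apply: initial_continuous.
  have : countable (A `&` N).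
    apply: contrapT => ANunc; apply: nB; exists (A `&` N); split=> //.
    rewrite -subset0 -clN; apply: setSI; apply: closureS; exact: subIsetr.
  apply: sub_countable; rewrite -preimage_setI.
  rewrite -(card_le_eql (inj_card_eq (in2W val_inj))).
  apply: subset_card_le; exact: image_preimage_subset.
apply: sub_countable Acnt; apply: card_le_trans (card_image_le set_val _).
apply: subset_card_le => p Ap.
by exists (SigSub (mem_set (AZ p Ap))).
Qed.
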